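(* For any graph $F\in\{C_k:k\ge5\}\cup\{P_k:k\ge1\}$ and any $\epsilon,C>0$, there exists $\delta>0$ such that the following holds. Let $G$ be an $n$-vertex graph with $\mathrm{Inj}(C_4,G)\le Cn^2$, and let $H\in[0,\infty)^{V(G)\times V(G)}$ be a symmetric matrix with $\mathrm{Tr}(H^4)\le Cn^4$, such that $$\left|\frac{\sum_{x,y}\mathbf{1}_G(x,y)a(x)b(y)}{n^{3/2}}-\frac{\sum_{x,y}H(x,y)a(x)b(y)}{n^2}\right|\le\delta\qquad\text{for all } a,b:V(G)\to\mathbf{C}\text{ with }\|a\|_2,\|b\|_2\le\sqrt n.$$ Then for every family $(A_v)_{v\in V(F)}$ of subsets $A_v\subset V(G)$, one has $$\left|\frac{\sum_{x_v\in A_v,\forall v\in V(F)}\prod_{\{u,v\}\in E(F)}\mathbf{1}_G(x_u,x_v)}{n^{|V(F)|-|E(F)|/2}}-\frac{\sum_{x_v\in A_v,\forall v\in V(F)}\prod_{\{u,v\}\in E(F)}H(x_u,x_v)}{n^{|V(F)|}}\right|\le\epsilon.$$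
   Context: Graphs are finite, unweighted, undirected and simple, with vertex set $V(\cdot)$ and edge set $E(\cdot)$; $\mathbf{1}_G(x,y)=1$ if $\{x,y\}\in E(G)$ and $0$ otherwise. $C_k$ is the cycle of length $k$ and $P_k$ is the path of length $k$ (with $k+1$ vertices and $k$ edges). $\mathrm{Inj}(C_4,G)$ is the number of injective graph homomorphisms from $C_4$ to $G$. Sums over $x,y$ range over $V(G)$, and $\|a\|_2:=\left(\sum_{x\in V(G)}|a(x)|^2\right)^{1/2}$. *)

(* Defs.v *)
From mathcomp Require Import all_boot all_order all_algebra.
From mathcomp Require Import reals exp.
From mathcomp Require Import complex.

Set Implicit Arguments.
Unset Strict Implicit.
Unset Printing Implicit Defensive.

Import Order.TTheory GRing.Theory Num.Theory.

Local Open Scope ring_scope.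
Local Open Scope complex_scope.

Record sgraph := SGraph {
  svertex :> finType;
  sedge : rel svertex;
  sedge_sym : symmetric sedge;
  sedge_irr : irreflexive sedge
}.

(* Each undirected edge appears exactly once, as the pair of its endpoints
   listed in the order of the enumeration of the vertices.  Products over
   edges are only taken of symmetric functions of the endpoints, so the
   orientation is immaterial. *)
Definition edges (F : sgraph) : {set F * F} :=
  [set p : F * F | sedge p.1 p.2 & (enum_rank p.1 < enum_rank p.2)%N].

Definition sgraph_iso (F F' : sgraph) : Prop :=
  exists2 f : F -> F', bijective f & forall u v, sedge (f u) (f v) = sedge u v.

(* [ordS i] is the successor of [i] modulo [k]; the condition [i != j] only
   matters for the degenerate value k = 1. *)
Definition cycle_rel (k : nat) : rel 'I_k :=
  fun i j => (i != j) && ((j == ordS i) || (i == ordS j)).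

Lemma cycle_rel_sym k : symmetric (@cycle_rel k).
Proof. by move=> i j; rewrite /cycle_rel eq_sym orbC. Qed.

Lemma cycle_rel_irr k : irreflexive (@cycle_rel k).
Proof. by move=> i; rewrite /cycle_rel eqxx. Qed.

Definition cycle_graph (k : nat) : sgraph :=
  SGraph (@cycle_rel_sym k) (@cycle_rel_irr k).

Definition path_rel (k : nat) : rel 'I_k.+1 :=
  fun i j => (j == i.+1 :> nat) || (i == j.+1 :> nat).

Lemma path_rel_sym k : symmetric (@path_rel k).
Proof. by move=> i j; rewrite /path_rel orbC. Qed.

Lemma path_rel_irr k : irreflexive (@path_rel k).
Proof. by move=> i; rewrite /path_rel orbb ltn_eqF. Qed.

(* The path of length k: k edges, k + 1 vertices. *)
Definition path_graph (k : nat) : sgraph :=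
  SGraph (@path_rel_sym k) (@path_rel_irr k).

Definition long_cycle_or_path (F : sgraph) : Prop :=
  (exists2 k, (5 <= k)%N & sgraph_iso F (cycle_graph k)) \/
  (exists2 k, (1 <= k)%N & sgraph_iso F (path_graph k)).

Definition inj_hom (F G : sgraph) : nat :=
  #|[set f : {ffun F -> G} |
      injectiveb f && [forall u, forall v, sedge u v ==> sedge (f u) (f v)]]|.

Definition indicator (R : realType) (G : sgraph) : G -> G -> R :=
  fun x y => (sedge x y)%:R.
Arguments indicator R G : clear implicits.

(* A V x V matrix as a MathComp matrix, through the enumeration of V. *)
Definition mx_of (R : realType) (V : finType) (H : V -> V -> R) : 'M[R]_#|V| :=
  \matrix_(i, j) H (enum_val i) (enum_val j).

Definition l2norm (R : realType) (V : finType) (a : V -> R[i]) : R :=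
  Num.sqrt (\sum_x Normc.normc (a x) ^+ 2).

(* Bilinear, without conjugation of b. *)
Definition bilin (R : realType) (V : finType) (w : V -> V -> R)
    (a b : V -> R[i]) : R[i] :=
  \sum_x \sum_y (w x y)%:C * a x * b y.

Definition hom_sum (R : realType) (F : sgraph) (V : finType)
    (A : F -> {set V}) (w : V -> V -> R) : R :=
  \sum_(x : {ffun F -> V} | [forall v, x v \in A v])
    \prod_(e in edges F) w (x e.1) (x e.2).

(* Main.v *)
(* With [n] the number of vertices, put [T1 := 1_G / sqrt n] and [T2 := H / n],
   as operators on [l^2].  The hypothesis says that [T1 - T2] has operator norm
   at most [delta], and the normalized counts of [F] are
   [n^(|E(F)| - |V(F)|)] times the counts weighted by [T1] and [T2].  Writing
   [P_v] for the diagonal projection onto [A_v], such a count is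
   [<1, P_0 T P_1 T ... T 1_(A_k)>] for a path and [tr (P_0 T P_1 T ...)] for a
   cycle.  The difference is telescoped, so that each term contains one factor
   [P (T1 - T2)].  For paths it is enough that [T1] and [T2] have bounded
   operator norm.  For cycles, at least four other factors are left: by
   Cauchy-Schwarz the trace is at most the product of the Frobenius norms of
   two pairs of factors and of operator norms, and since all entries are
   nonnegative the projections can be dropped from the pairs, whose norms are
   then bounded by [tr T^4].  Finally [tr T1^4] is bounded: the degenerate
   4-cycles contribute at most [2 n^-2] times the sum of the squared degrees,
   that is, [2 |T1 1|^2 / n], which is at most twice the squared operator norm
   of [T1]. *)
Require Import Defs.
From mathcomp Require Import all_boot all_order all_algebra.
From mathcomp Require Import reals exp.
From mathcomp Require Import complex ring lra zify.

Set Implicit Arguments.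
Unset Strict Implicit.
Unset Printing Implicit Defensive.

Import Order.TTheory GRing.Theory Num.Theory.

Local Open Scope ring_scope.

(** * Frobenius and operator norms *)

Section FrobeniusNorm.
Variable R : rcfType.

Lemma sum_sqr_eq0 (I : finType) (f : I -> R) :
  \sum_i f i ^+ 2 = 0 -> forall i, f i = 0.
Proof.
move=> f0 i; apply/eqP; rewrite -sqrf_eq0; apply/eqP.
exact: (psumr_eq0P (fun i _ => sqr_ge0 (f i)) f0).
Qed.

(** The sum of [(a * g i - c * f i) ^+ 2] is [a * (a * b - c ^+ 2)]; if [a = 0], then [f] vanishes
    and so does [c]. *)
Lemma cauchy_schwarz (I : finType) (f g : I -> R) :
  (\sum_i f i * g i) ^+ 2 <= (\sum_i f i ^+ 2) * (\sum_i g i ^+ 2).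
Proof.
set a := \sum_i f i ^+ 2; set b := \sum_i g i ^+ 2; set c := \sum_i f i * g i.
have a0 : 0 <= a by apply: sumr_ge0 => i _; exact: sqr_ge0.
have : 0 <= \sum_i (a * g i - c * f i) ^+ 2.
  by apply: sumr_ge0 => i _; exact: sqr_ge0.
have -> : \sum_i (a * g i - c * f i) ^+ 2 = a * (a * b - c ^+ 2).
  transitivity (\sum_i (a ^+ 2 * g i ^+ 2 - 2 * a * c * (f i * g i)
                        + c ^+ 2 * f i ^+ 2)).
    by apply: eq_bigr => i _; ring.
  by rewrite big_split /= sumrB -!mulr_sumr -/a -/b -/c; ring.
have [a1|aN] := ltP 0 a; first by rewrite pmulr_rge0 // subr_ge0.
have fi : forall i, f i = 0 by apply: sum_sqr_eq0; apply: le_anti; rewrite -/a aN.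
have -> : c = 0 by rewrite /c big1 // => i _; rewrite fi mul0r.
have a_eq0 : a = 0 by apply: le_anti; rewrite aN.
by rewrite a_eq0 expr0n !mul0r.
Qed.

(** Kept squared to avoid roots; on row and column vectors it is the squared Euclidean norm. *)
Definition frob2 m n (A : 'M[R]_(m, n)) : R := \sum_i \sum_j A i j ^+ 2.

Lemma frob2_ge0 m n (A : 'M_(m, n)) : 0 <= frob2 A.
Proof. by do 2 apply: sumr_ge0 => ? _; exact: sqr_ge0. Qed.

Lemma frob2_tr m n (A : 'M_(m, n)) : frob2 A^T = frob2 A.
Proof.
rewrite /frob2 exchange_big; apply: eq_bigr => i _.
by apply: eq_bigr => j _; rewrite mxE.
Qed.

Lemma frob2_mxtrace m n (A : 'M_(m, n)) : frob2 A = \tr (A *m A^T).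
Proof.
apply: eq_bigr => i _; rewrite mxE; apply: eq_bigr => j _.
by rewrite mxE expr2.
Qed.

Lemma frob2_eq0 m n (A : 'M_(m, n)) : frob2 A = 0 -> A = 0.
Proof.
rewrite /frob2 pair_big /= => /(@sum_sqr_eq0 _ (fun p => A p.1 p.2)) A0.
by apply/matrixP => i j; rewrite mxE (A0 (i, j)).
Qed.

Lemma frob2Z m n c (A : 'M_(m, n)) : frob2 (c *: A) = c ^+ 2 * frob2 A.
Proof.
rewrite /frob2 mulr_sumr; apply: eq_bigr => i _; rewrite mulr_sumr.
by apply: eq_bigr => j _; rewrite mxE exprMn.
Qed.

Lemma frob2_row m n (A : 'M_(m, n)) : frob2 A = \sum_i frob2 (row i A).
Proof.
apply: eq_bigr => i _; rewrite /frob2 big_ord1.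
by apply: eq_bigr => j _; rewrite mxE.
Qed.

Lemma frob2D m n (A B : 'M_(m, n)) :
  frob2 (A + B) <= 2 * frob2 A + 2 * frob2 B.
Proof.
rewrite /frob2 !mulr_sumr -big_split; apply: ler_sum => i _.
rewrite !mulr_sumr -big_split /=; apply: ler_sum => j _; rewrite mxE.
have := sqr_ge0 (A i j - B i j); nra.
Qed.

Lemma frob2_le m n (A B : 'M_(m, n)) :
  (forall i j, 0 <= A i j <= B i j) -> frob2 A <= frob2 B.
Proof.
move=> AB; apply: ler_sum => i _; apply: ler_sum => j _.
by have /andP[A0 AleB] := AB i j; rewrite ler_sqr ?nnegrE // (le_trans A0).
Qed.

(** Cauchy-Schwarz for the entrywise inner product of [A] and [B^T]. *)
Lemma mxtraceM_frob2 m n (A : 'M_(m, n)) (B : 'M_(n, m)) :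
  \tr (A *m B) ^+ 2 <= frob2 A * frob2 B.
Proof.
rewrite -(frob2_tr B) /mxtrace /frob2 !pair_big /=.
under eq_bigr do rewrite mxE.
rewrite pair_big /=.
have := cauchy_schwarz (fun p => A p.1 p.2) (fun p => B^T p.1 p.2).
by under [X in X ^+ 2 <= _ -> _]eq_bigr do rewrite mxE.
Qed.

Lemma frob2M m n p (A : 'M_(m, n)) (B : 'M_(n, p)) :
  frob2 (A *m B) <= frob2 A * frob2 B.
Proof.
rewrite -(frob2_tr B) {2}/frob2 mulr_suml; apply: ler_sum => i _.
rewrite {1}/frob2 mulr_sumr; apply: ler_sum => k _; rewrite mxE.
apply: le_trans (cauchy_schwarz _ _) _.
by under [X in _ <= _ * X]eq_bigr do rewrite mxE.
Qed.

(* [c] bounds the square of the operator norm of [A]. *)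
Definition opbound2 m n (A : 'M[R]_(m, n)) (c : R) :=
  forall u : 'rV_m, frob2 (u *m A) <= c * frob2 u.

Lemma frob2M_opbound2 m n p (B : 'M_(m, n)) (A : 'M_(n, p)) c :
  opbound2 A c -> frob2 (B *m A) <= c * frob2 B.
Proof.
move=> Ac; rewrite frob2_row (frob2_row B) mulr_sumr.
by apply: ler_sum => i _; rewrite row_mul.
Qed.

Lemma opbound2M m n p (A : 'M_(m, n)) (B : 'M_(n, p)) a b :
  0 <= b -> opbound2 A a -> opbound2 B b -> opbound2 (A *m B) (a * b).
Proof.
move=> b0 Aa Bb u; rewrite mulmxA (mulrC a) -mulrA.
by apply: le_trans (Bb _) _; rewrite ler_wpM2l.
Qed.

Lemma opbound2_1 n : opbound2 (1%:M : 'M_n) 1.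
Proof. by move=> u; rewrite mulmx1 mul1r. Qed.

Lemma opbound2D m n (A B : 'M_(m, n)) a b :
  opbound2 A a -> opbound2 B b -> opbound2 (A + B) (2 * a + 2 * b).
Proof.
move=> Aa Bb u; rewrite mulmxDr; apply: le_trans (frob2D _ _) _.
by rewrite [leRHS]mulrDl -!mulrA lerD // ler_pM2l.
Qed.

Lemma opbound2_le m n (A : 'M_(m, n)) a b :
  opbound2 A a -> a <= b -> opbound2 A b.
Proof.
by move=> Aa ab u; apply: le_trans (Aa u) _; rewrite ler_wpM2r ?frob2_ge0.
Qed.

Lemma opbound2_prod n (M : nat -> 'M[R]_n) c i k :
  0 <= c -> (forall t, opbound2 (M t) c) ->
  opbound2 (\prod_(i <= t < i + k) M t) (c ^+ k).
Proof.
move=> c0 Mc; elim: k => [|k IH]; first by rewrite addn0 big_geq //; exact: opbound2_1.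
by rewrite addnS big_nat_recr ?leq_addr //= exprSr -mulmxE; apply: opbound2M.
Qed.

(** The squared norm of [u *m T] is the inner product of [u *m T *m T] with [u]. This turns a fourth
    moment bound into an operator norm bound. *)
Lemma opbound2_sym n (T : 'M_n) c : 0 <= c -> T^T = T ->
  frob2 (T *m T) <= c ^+ 2 -> opbound2 T c.
Proof.
move=> c0 Tsym TT u.
rewrite -ler_sqr ?nnegrE ?frob2_ge0 ?mulr_ge0 ?frob2_ge0 //.
have -> : frob2 (u *m T) = \tr (u *m T *m T *m u^T).
  by rewrite frob2_mxtrace trmx_mul Tsym !mulmxA.
apply: le_trans (mxtraceM_frob2 _ _) _; rewrite frob2_tr exprMn expr2 mulrA.
rewrite ler_wpM2r ?frob2_ge0 // -mulmxA mulrC.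
by apply: le_trans (frob2M _ _) _; rewrite ler_wpM2l ?frob2_ge0.
Qed.

(** Pairing [u] with [v = u *m D] detects the norm of [v]. The form is controlled only on the ball
    of radius [sqrt n], so nonzero [u] and [v] are rescaled to that radius. *)
Lemma opbound2_bilin (n : nat) (D : 'M_n) (c : R) :
  0 <= c ->
  (forall u v : 'rV_n, frob2 u <= n%:R -> frob2 v <= n%:R ->
     `|(u *m D *m v^T) 0 0| <= c * n%:R) -> opbound2 D (c ^+ 2).
Proof.
move=> c0 H u.
have [/frob2_eq0 ->|u0] := eqVneq (frob2 u) 0.
  by rewrite mul0mx -[X in frob2 X](scale0r 0) frob2Z expr0n mul0r mulr_ge0
    ?sqr_ge0 ?frob2_ge0.
set v := u *m D.
have [->|v0] := eqVneq (frob2 v) 0; first by rewrite mulr_ge0 ?sqr_ge0 ?frob2_ge0.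
have fu : 0 < frob2 u by rewrite lt0r u0 frob2_ge0.
have fv : 0 < frob2 v by rewrite lt0r v0 frob2_ge0.
have n0 : (0 : R) <= n%:R by [].
have n1 : (0 : R) < n%:R.
  rewrite ltr0n lt0n; apply: contraNneq u0 => n0'.
  by move: u {v v0 fu fv H}; rewrite n0' => u; rewrite /frob2 big_ord1 big_ord0.
set a := Num.sqrt (n%:R / frob2 u); set b := Num.sqrt (n%:R / frob2 v).
have a2 : a ^+ 2 * frob2 u = n%:R by rewrite sqr_sqrtr ?divfK // divr_ge0 // ltW.
have b2 : b ^+ 2 * frob2 v = n%:R by rewrite sqr_sqrtr ?divfK // divr_ge0 // ltW.
have := H (a *: u) (b *: v); rewrite !frob2Z a2 b2 lexx => /(_ isT isT).
have -> : (a *: u *m D *m (b *: v)^T) 0 0 = a * b * frob2 v.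
  rewrite linearZ /= -scalemxAr -scalemxAl -scalemxAl scalerA mulrC -/v.
  by rewrite mxE frob2_mxtrace /mxtrace big_ord1 (mulrC a).
rewrite -ler_sqr ?nnegrE ?mulr_ge0 // real_normK ?num_real // !exprMn.
have -> : a ^+ 2 * b ^+ 2 * frob2 v ^+ 2 = n%:R ^+ 2 * (frob2 v / frob2 u).
  transitivity ((a ^+ 2 * frob2 u) * (b ^+ 2 * frob2 v) * (frob2 v / frob2 u)).
    by field.
  by rewrite a2 b2 -expr2.
by rewrite [leRHS]mulrC ler_pM2l ?exprn_gt0 // ler_pdivrMr.
Qed.

Lemma telescope_prod (A : pzRingType) (a b : nat -> A) k :
  \prod_(0 <= t < k) a t - \prod_(0 <= t < k) b t =
  \sum_(j < k) (\prod_(0 <= t < j) a t) * (a j - b j)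
               * \prod_(j.+1 <= t < k) b t.
Proof.
elim: k => [|k IH]; first by rewrite big_ord0 !big_geq // subrr.
rewrite big_ord_recr /= [X in _ + _ * X]big_geq // mulr1.
rewrite !big_nat_recr //= mulrBr.
rewrite [LHS](_ : _ = (\prod_(0 <= i < k) a i - \prod_(0 <= i < k) b i) * b k
   + (\prod_(0 <= i < k) a i * a k - \prod_(0 <= i < k) a i * b k)); last first.
  by rewrite mulrBl [RHS]addrC addrA subrK.
congr (_ + _); rewrite IH mulr_suml; apply: eq_bigr => j _.
by rewrite big_nat_recr //= mulrA.
Qed.

End FrobeniusNorm.

(** * Telescoping of masked products *)

Section Telescoping.
Variables (R : rcfType) (n : nat) (T1 T2 : 'M[R]_n) (K delta : R).
Hypotheses (K1 : 1 <= K) (delta0 : 0 <= delta).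
Hypotheses (T1_sym : T1^T = T1) (T2_sym : T2^T = T2).
Hypotheses (T1_ge0 : forall i j, 0 <= T1 i j) (T2_ge0 : forall i j, 0 <= T2 i j).
Hypotheses (T1_op : opbound2 T1 K) (T2_op : opbound2 T2 K).
Hypothesis T12_op : opbound2 (T1 - T2) (delta ^+ 2).

Let K0 : 0 <= K. Proof. exact: le_trans ler01 K1. Qed.

Lemma opbound2_diag (d : 'rV[R]_n) :
  (forall i, 0 <= d 0 i <= 1) -> opbound2 (diag_mx d) 1.
Proof.
move=> d01 u; rewrite mul1r; apply: ler_sum => i _; apply: ler_sum => j _.
rewrite mul_mx_diag mxE exprMn ler_piMr ?sqr_ge0 //.
by have /andP[? ?] := d01 j; rewrite exprn_ile1.
Qed.

(** Cyclicity of the trace separates [S *m S] from [T *m T], so a mixed product is controlled by the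
    two fourth moments. *)
Lemma frob2M_sym (S T : 'M[R]_n) (c : R) : 0 <= c -> S^T = S -> T^T = T ->
  frob2 (S *m S) <= c -> frob2 (T *m T) <= c -> frob2 (S *m T) <= c.
Proof.
move=> c0 Ssym Tsym SS TT; rewrite -ler_sqr ?nnegrE ?frob2_ge0 //.
have -> : frob2 (S *m T) = \tr ((S *m S) *m (T *m T)).
  rewrite frob2_mxtrace trmx_mul Ssym Tsym [LHS]mxtrace_mulC.
  by rewrite -mulmxA [LHS]mxtrace_mulC !mulmxA.
apply: le_trans (mxtraceM_frob2 _ _) _.
by rewrite expr2 ler_pM ?frob2_ge0.
Qed.

(** The weights [d] stand for the indicator of some [A_v]; both operators are allowed because a
    telescoped product mixes them. *)
Definition masked (M : 'M[R]_n) :=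
  exists d : 'rV[R]_n, (forall i, 0 <= d 0 i <= 1) /\
    (M = diag_mx d *m T1 \/ M = diag_mx d *m T2).

Lemma masked_opbound2 M : masked M -> opbound2 M K.
Proof.
case=> d [d01 [] ->]; rewrite -[K]mul1r; apply: opbound2M => //;
  exact: opbound2_diag.
Qed.

Lemma opbound2_masked_diff (d : 'rV[R]_n) : (forall i, 0 <= d 0 i <= 1) ->
  opbound2 (diag_mx d *m T1 - diag_mx d *m T2) (delta ^+ 2).
Proof.
move=> d01; rewrite -mulmxBr -[delta ^+ 2]mul1r.
by apply: opbound2M; [exact: sqr_ge0|exact: opbound2_diag|].
Qed.

Lemma masked_prod_bilin (X Y D : 'M[R]_n) (a b : nat) (u : 'rV[R]_n)
    (v : 'cV[R]_n) :
  opbound2 X (K ^+ a) -> opbound2 Y (K ^+ b) -> opbound2 D (delta ^+ 2) ->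
  frob2 u <= n%:R -> frob2 v <= n%:R ->
  `|(u *m (X *m D *m Y) *m v) 0 0| <= n%:R * (delta * K ^+ (a + b)).
Proof.
move=> Xa Yb Dd un vn; have n0 : (0 : R) <= n%:R by [].
rewrite -ler_sqr ?nnegrE ?normr_ge0 ?mulr_ge0 ?exprn_ge0 //.
rewrite real_normK ?num_real //.
have tr11 (M : 'M[R]_1) : M 0 0 = \tr M by rewrite /mxtrace big_ord1.
rewrite tr11.
apply: le_trans (mxtraceM_frob2 _ _) _.
rewrite exprMn expr2 [leRHS]mulrAC; apply: ler_pM; rewrite ?frob2_ge0 //.
have XDY : opbound2 (X *m D *m Y) (K ^+ a * delta ^+ 2 * K ^+ b).
  by do 2 (apply: opbound2M; rewrite ?exprn_ge0 //).
apply: le_trans (XDY _) _; rewrite mulrC; apply: ler_pM => //.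
- exact: frob2_ge0.
- by rewrite !mulr_ge0 ?exprn_ge0.
(* The power [K ^+ (a + b)] obtained is at most its own square since [K >= 1]; this avoids a root of
   [K]. *)
- rewrite exprMn mulrAC mulrC -exprD ler_wpM2l ?sqr_ge0 //.
  by rewrite ler_eXnr ?exprn_ege1.
Qed.

Hypotheses (T1_C4 : frob2 (T1 *m T1) <= K) (T2_C4 : frob2 (T2 *m T2) <= K).

(** Masks only lower nonnegative entries, so [M *m N] is dominated entrywise by the unmasked
    product, to which [frob2M_sym] applies. *)
Lemma masked_pair M N : masked M -> masked N -> frob2 (M *m N) <= K.
Proof.
have entry (d : 'rV[R]_n) (T : 'M[R]_n) : (forall i j, 0 <= T i j) ->
    (forall i, 0 <= d 0 i <= 1) ->
    forall i j, 0 <= (diag_mx d *m T) i j <= T i j.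
  move=> T0 d01 i j; have /andP[? ?] := d01 i; rewrite mul_diag_mx mxE.
  by rewrite mulr_ge0 //= ler_piMl.
have dom P : masked P -> exists T, [/\ T^T = T, frob2 (T *m T) <= K &
    forall i j, 0 <= P i j <= T i j].
  case=> d [d01 [] ->]; [exists T1|exists T2]; split => //; exact: entry.
move=> /dom [S [Ssym SK MS]] /dom [T [Tsym TK NT]].
apply: le_trans (frob2M_sym K0 Ssym Tsym SK TK).
apply: frob2_le => i j; rewrite !mxE; apply/andP; split.
  apply: sumr_ge0 => k _; case/andP: (MS i k) => ? _.
  by case/andP: (NT k j) => ? _; rewrite mulr_ge0.
apply: ler_sum => k _; case/andP: (MS i k) => ? ?.
by case/andP: (NT k j) => ? ?; rewrite ler_pM.
Qed.

(** Two pairs of factors are measured in Frobenius norm, the other [m - 4] factors and [D] in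
    operator norm. *)
Lemma masked_prod_trace (N : nat -> 'M[R]_n) (D : 'M[R]_n) (m : nat) :
  (4 <= m)%N -> (forall t, masked (N t)) -> opbound2 D (delta ^+ 2) ->
  `|\tr ((\prod_(0 <= t < m) N t) * D)| <= delta * K ^+ m.
Proof.
move=> m4 NM Dd.
rewrite -ler_sqr ?nnegrE ?normr_ge0 ?mulr_ge0 ?exprn_ge0 //.
rewrite real_normK ?num_real //.
have -> : \prod_(0 <= t < m) N t =
    (N 0 *m N 1) *m ((N 2 *m N 3) *m \prod_(4 <= t < 4 + (m - 4)) N t).
  rewrite -{1}(subnKC m4) big_ltn // big_ltn // big_ltn // big_ltn //.
  by rewrite -!mulmxE !mulmxA.
rewrite -!mulmxE -(mulmxA (N 0 *m N 1)); apply: le_trans (mxtraceM_frob2 _ _) _.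
have RD := opbound2M (sqr_ge0 delta)
  (opbound2_prod 4 (m - 4) K0 (fun t => masked_opbound2 (NM t))) Dd.
rewrite -mulmxA; apply: (@le_trans _ _ (K * (K ^+ (m - 4) * delta ^+ 2 * K))).
  apply: ler_pM; rewrite ?frob2_ge0 ?masked_pair //.
  apply: le_trans (frob2M_opbound2 _ RD) _.
  by rewrite ler_wpM2l ?masked_pair ?mulr_ge0 ?exprn_ge0.
(* The exponent [m - 2] counts one [K] per pair and one per remaining factor; it is then raised to
   [m * 2] by [K >= 1]. *)
rewrite [leLHS](_ : _ = delta ^+ 2 * K ^+ (m - 2)); last first.
  rewrite (_ : (m - 2 = (m - 4).+2)%N); last by lia.
  by rewrite !exprS; ring.
by rewrite exprMn ler_wpM2l ?sqr_ge0 // -exprM ler_weXn2l //; lia.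
Qed.

Variable d : nat -> 'rV[R]_n.
Hypothesis d01 : forall t i, 0 <= d t 0 i <= 1.

Let A t := diag_mx (d t) *m T1.
Let B t := diag_mx (d t) *m T2.

Let A_masked t : masked (A t). Proof. by exists (d t); split => //; left. Qed.
Let B_masked t : masked (B t). Proof. by exists (d t); split => //; right. Qed.

Lemma path_telescope k (u : 'rV[R]_n) (v : 'cV[R]_n) :
  frob2 u <= n%:R -> frob2 v <= n%:R ->
  `|(u *m \prod_(0 <= t < k) A t *m v) 0 0
    - (u *m \prod_(0 <= t < k) B t *m v) 0 0|
  <= n%:R * (k%:R * (delta * K ^+ k)).
Proof.
move=> un vn.
have -> : (u *m \prod_(0 <= t < k) A t *m v) 0 0
    - (u *m \prod_(0 <= t < k) B t *m v) 0 0
    = (u *m (\prod_(0 <= t < k) A t - \prod_(0 <= t < k) B t) *m v) 0 0.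
  by rewrite mulmxBr mulmxBl [RHS]mxE [X in _ = _ + X]mxE.
rewrite telescope_prod mulmx_sumr mulmx_suml summxE.
apply: le_trans (ler_norm_sum _ _ _) _.
rewrite [leRHS](_ : _ = \sum_(j < k) n%:R * (delta * K ^+ k)); last first.
  by rewrite sumr_const card_ord -mulr_natl; ring.
apply: ler_sum => j _.
rewrite -!mulmxE.
apply: le_trans (masked_prod_bilin (a := j) (b := k - j.+1) _ _ _ un vn) _.
- by have := opbound2_prod 0 j K0 (fun t => masked_opbound2 (A_masked t)).
- have := opbound2_prod j.+1 (k - j.+1) K0
    (fun t => masked_opbound2 (B_masked t)).
  by rewrite subnKC.
- exact: opbound2_masked_diff.
by rewrite ler_wpM2l // ler_wpM2l // ler_weXn2l //; have := ltn_ord j; clear; lia.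
Qed.

Lemma cycle_telescope k : (5 <= k)%N ->
  `|\tr (\prod_(0 <= t < k) A t) - \tr (\prod_(0 <= t < k) B t)|
  <= k%:R * (delta * K ^+ k).
Proof.
move=> k5; rewrite -raddfB /= telescope_prod raddf_sum /=.
apply: le_trans (ler_norm_sum _ _ _) _.
rewrite [leRHS](_ : _ = \sum_(j < k) delta * K ^+ k); last first.
  by rewrite sumr_const card_ord -[RHS]mulr_natl.
apply: ler_sum => -[j jk] _ /=.
(* Rotating the trace puts the difference last. The other [k - 1 >= 4] factors are listed cyclically
   by [N] from position [j + 1]: the [B]s up to the end, then the [A]s before [j]. *)
rewrite -mulmxE mxtrace_mulC mulmxA !mulmxE.
pose N s := if (j.+1 + s < k)%N then B (j.+1 + s) else A (j.+1 + s - k).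
have -> : (\prod_(j.+1 <= t < k) B t) * (\prod_(0 <= t < j) A t) =
    \prod_(0 <= s < k.-1) N s.
  rewrite [RHS](@big_cat_nat _ _ _ (k - j.+1)) //=; last by lia.
  congr (_ * _).
    rewrite -{1}(add0n j.+1) big_addn; apply: eq_big_nat => s sk.
    by rewrite /N addnC; case: ifP => //; lia.
  rewrite -[in RHS](add0n (k - j.+1)%N) [RHS]big_addn.
  rewrite (_ : (k.-1 - (k - j.+1) = j)%N); last by lia.
  apply: eq_big_nat => s sj; rewrite /N.
  by case: ifP => [|_]; [lia|congr (A _); lia].
apply: le_trans (masked_prod_trace _ _ _) _.
- by lia.
- by move=> s; rewrite /N; case: ifP.
- exact: opbound2_masked_diff.
by rewrite ler_wpM2l // ler_weXn2l //; lia.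
Qed.

End Telescoping.

(** * Path and cycle counts as matrix products *)

Section WalkSums.
Variable R : comNzRingType.

Definition ffun_cons (T : finType) k (i : T) (y : {ffun 'I_k -> T}) :
  {ffun 'I_k.+1 -> T} := [ffun t => oapp y i (unlift ord0 t)].

Lemma ffun_cons0 (T : finType) k (i : T) (y : {ffun 'I_k -> T}) :
  ffun_cons i y ord0 = i.
Proof. by rewrite ffunE unlift_none. Qed.

Lemma ffun_consS (T : finType) k (i : T) (y : {ffun 'I_k -> T}) t :
  ffun_cons i y (lift ord0 t) = y t.
Proof. by rewrite ffunE liftK. Qed.

Lemma sum_ffun_cons (T : finType) k (Phi : {ffun 'I_k.+1 -> T} -> R) :
  \sum_x Phi x = \sum_i \sum_(y : {ffun 'I_k -> T}) Phi (ffun_cons i y).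
Proof.
rewrite pair_big /= (reindex (fun p : T * {ffun 'I_k -> T} => ffun_cons p.1 p.2)) //.
exists (fun x : {ffun 'I_k.+1 -> T} => (x ord0, [ffun t => x (lift ord0 t)])).
  move=> [i y] _ /=; rewrite ffun_cons0; congr pair.
  by apply/ffunP => t; rewrite ffunE ffun_consS.
move=> x _; apply/ffunP => t; rewrite ffunE /=.
by case: unliftP => [s|] ->; rewrite /= ?ffunE.
Qed.

(** The free weight [phi] carries the last mask for paths and the closing edge for cycles. In the
    induction the first vertex is split off and the first factor absorbed into [phi]. *)
Lemma walk_sum n k (M : nat -> 'M[R]_n) (phi : 'I_n -> 'I_n -> R) :
  \sum_(x : {ffun 'I_k.+1 -> 'I_n})
     phi (x ord0) (x ord_max) *
     \prod_(t < k) M t (x (widen_ord (leqnSn k) t)) (x (lift ord0 t)) =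
  \sum_i \sum_j phi i j * (\prod_(0 <= t < k) M t) i j.
Proof.
elim: k M phi => [|k IH] M phi.
  rewrite sum_ffun_cons; apply: eq_bigr => i _.
  rewrite [RHS](bigD1 i) //= [X in _ = _ + X]big1 => [|j ji]; last first.
    by rewrite big_geq // mxE eq_sym (negPf ji) mulr0.
  rewrite addr0 big_geq // mxE eqxx.
  rewrite (big_pred1 [ffun t : 'I_0 => i]) => [|y]; last first.
    by symmetry; apply/eqP/ffunP => -[].
  by rewrite big_ord0 (_ : ord_max = ord0) ?ffun_cons0 //; apply: val_inj.
rewrite sum_ffun_cons; apply: eq_bigr => i _.
transitivity (\sum_a \sum_b phi i b * M 0%N i a * (\prod_(0 <= t < k) M t.+1) a b).
  rewrite -(IH (fun t => M t.+1) (fun a b => phi i b * M 0%N i a)).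
  apply: eq_bigr => y _; rewrite big_ord_recl ffun_cons0.
  have -> : ord_max = lift ord0 (@ord_max k) :> 'I_k.+2 by apply: val_inj.
  rewrite !ffun_consS mulrA; congr (_ * _ * _).
    congr (M _ _ _).
    by rewrite (_ : widen_ord _ _ = ord0) ?ffun_cons0 //; apply: val_inj.
  apply: eq_bigr => t _; rewrite ffun_consS; congr (M _ _ _).
  by rewrite (_ : widen_ord _ _ = lift ord0 (widen_ord (leqnSn k) t))
    ?ffun_consS //; apply: val_inj.
rewrite exchange_big /=; apply: eq_bigr => b _.
rewrite big_nat_recl // -mulmxE mxE mulr_sumr.
by apply: eq_bigr => a _; rewrite mulrA.
Qed.

End WalkSums.

(* [e] lists every edge of [r] exactly once, in one of its two orientations. *)
Definition orients m l (r : rel 'I_m) (e : 'I_l -> 'I_m * 'I_m) : Prop :=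
  [/\ forall t, r (e t).1 (e t).2,
      forall s t, e s = e t \/ e s = ((e t).2, (e t).1) -> s = t &
      forall i j, r i j -> exists t, e t = (i, j) \/ e t = (j, i)].

Definition path_edge m (t : 'I_m) : 'I_m.+1 * 'I_m.+1 :=
  (widen_ord (leqnSn m) t, lift ord0 t).

Lemma path_edge_orients m : orients (@path_rel m) (@path_edge m).
Proof.
split=> [t|s t|i j]; first by rewrite /path_rel /= eqxx.
  by case=> -[] st st'; apply: val_inj; move: st st' => /=; rewrite /bump; lia.
have H (a b : 'I_m.+1) : b = a.+1 :> nat -> exists t, path_edge t = (a, b).
  move=> ba; have am : (a < m)%N by rewrite -ltnS -ba.
  by exists (Ordinal am); congr pair; apply: val_inj; rewrite /= /bump -?ba.
by case/orP => /eqP /H [t tE]; exists t; [left|right].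
Qed.

Definition cycle_edge m (t : 'I_m) : 'I_m * 'I_m := (t, ordS t).

(** With two vertices, [(0, 1)] and [(1, 0)] would list the same edge twice. *)
Lemma cycle_edge_orients m : (3 <= m)%N ->
  orients (@cycle_rel m) (@cycle_edge m).
Proof.
case: m => // m m2; split=> [t|s t|i j].
- rewrite /cycle_rel /= eqxx andbT; apply/eqP => /(congr1 val) /=.
  case: t => t /= tm; have [->|tm'] := eqVneq t m; first by rewrite modnn; lia.
  by rewrite modn_small; lia.
(* A reversed coincidence would give [t + 2 = t] modulo the length; the cases are the places where
   the successor wraps around. *)
- case=> -[] // -> st; exfalso; move/(congr1 val): st => /=.
  case: t => t /= tm; have [->|tm'] := eqVneq t m.
    by rewrite modnn modn_small; lia.
  rewrite [(t.+1 %% m.+1)%N]modn_small; last by lia.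
  have [tm''|tm''] := eqVneq t.+1 m; first by rewrite tm'' modnn; lia.
  by rewrite modn_small; lia.
- case/andP=> _ /orP[] /eqP ->; first by exists i; left.
  by exists j; right.
Qed.

(** * Edge sets read through an orientation *)

Section Orientation.
Variables (F : sgraph) (m : nat) (f : F -> 'I_m) (g : 'I_m -> F).
Hypotheses (fK : cancel f g) (gK : cancel g f).
Variables (r : rel 'I_m) (l : nat) (e : 'I_l -> 'I_m * 'I_m).
Hypotheses (g_edge : forall i j, sedge (g i) (g j) = r i j) (e_or : orients r e).

(** Turns a listed edge to the orientation used by [edges], so that products over [edges F] can be
    reindexed by ['I_l]. *)
Definition sorted_edge t : F * F :=
  if (enum_rank (g (e t).1) < enum_rank (g (e t).2))%N
  then (g (e t).1, g (e t).2) else (g (e t).2, g (e t).1).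

Lemma sorted_edge_inj : injective sorted_edge.
Proof.
have g_inj := can_inj gK; have [_ e_inj _] := e_or.
move=> s t st; apply: e_inj; move: st; rewrite /sorted_edge.
by case: (e s) (e t) => [a b] [a' b'] /=; case: ifP => _; case: ifP => _;
  move=> [] /g_inj -> /g_inj ->; [left|right|right|left].
Qed.

Lemma edges_sorted_edge : edges F = [set sorted_edge t | t : 'I_l].
Proof.
have [e_edge _ e_surj] := e_or.
apply/setP => -[u v]; rewrite inE /=; apply/andP/imsetP => [[uv ruv]|[t _]].
  have [t et] : exists t, e t = (f u, f v) \/ e t = (f v, f u).
    by apply: e_surj; rewrite -g_edge !fK.
  exists t => //; rewrite /sorted_edge.
  case: et => -> /=; rewrite !fK ?ruv //.
  by rewrite ltnNge (ltnW ruv).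
rewrite /sorted_edge; case: ltngtP => [lt|gt|eq] [-> ->].
- by rewrite g_edge e_edge lt.
- by rewrite sedge_sym g_edge e_edge gt.
- have := e_edge t; have /enum_rank_inj /(can_inj gK) -> := ord_inj eq.
  by rewrite -g_edge sedge_irr.
Qed.

Lemma card_edges_orients : #|edges F| = l.
Proof.
by rewrite edges_sorted_edge card_imset ?card_ord //; exact: sorted_edge_inj.
Qed.

End Orientation.

Section HomSums.
Variables (R : realType) (F : sgraph) (V : finType).
Variables (A : F -> {set V}) (w : V -> V -> R).
Hypothesis w_sym : forall x y, w x y = w y x.
Variables (m : nat) (f : F -> 'I_m.+1) (g : 'I_m.+1 -> F).
Hypotheses (fK : cancel f g) (gK : cancel g f).

(** Indexed by [nat] to fit products over ranges; beyond [m], [inord] falls back to index 0 and the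
    entries are still 0 or 1. *)
Definition mask (t : nat) : 'rV[R]_#|V| :=
  \row_i (enum_val i \in A (g (inord t)))%:R.

Lemma mask01 t i : 0 <= mask t 0 i <= 1.
Proof. by rewrite mxE; case: (_ \in _); rewrite ?lexx ?ler01. Qed.

(** Vertices are renamed by ordinals and the membership constraint becomes a product of 0/1 factors;
    symmetry of [w] makes the orientation immaterial. *)
Lemma hom_sum_orients (r : rel 'I_m.+1) l (e : 'I_l -> 'I_m.+1 * 'I_m.+1) :
    (forall i j, sedge (g i) (g j) = r i j) -> orients r e ->
  hom_sum A w = \sum_(y : {ffun 'I_m.+1 -> 'I_#|V|})
    (\prod_(i < m.+1) mask i 0 (y i)) *
    \prod_(t < l) mx_of w (y (e t).1) (y (e t).2).
Proof.
move=> g_edge e_or; rewrite /hom_sum big_mkcond.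
rewrite (reindex (fun y : {ffun 'I_m.+1 -> 'I_#|V|} =>
   [ffun v => enum_val (y (f v))] : {ffun F -> V})) /=; last first.
  exists (fun x : {ffun F -> V} => [ffun i => enum_rank (x (g i))]) => x _;
    apply/ffunP => i; rewrite !ffunE.
    by rewrite enum_valK gK.
  by rewrite enum_rankK fK.
apply: eq_bigr => y _.
have -> : \prod_(i < m.+1) mask i 0 (y i) =
    [forall v, [ffun v => enum_val (y (f v))] v \in A v]%:R.
  case: (boolP [forall v, [ffun v => enum_val (y (f v))] v \in A v]).
    move=> /forallP yA.
    rewrite big1 // => i _; rewrite mxE inord_val.
    by have := yA (g i); rewrite ffunE gK => ->.
  rewrite negb_forall => /existsP[v]; rewrite ffunE => yA.
  by rewrite (bigD1 (f v)) //= mxE inord_val fK (negPf yA) mul0r.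
case: ifP => _; rewrite ?mul0r // mul1r (edges_sorted_edge fK gK g_edge e_or).
rewrite big_imset /=; last by move=> ? ? _ _; exact: (sorted_edge_inj gK e_or).
apply: eq_bigr => t _; rewrite mxE /sorted_edge !ffunE.
by case: ifP => _ /=; rewrite !gK // w_sym.
Qed.

Let step (t : nat) := diag_mx (mask t) *m mx_of w.

Let stepE t i j : step t i j = mask t 0 i * mx_of w i j.
Proof. by rewrite /step mul_diag_mx mxE. Qed.

(** Step [t] carries the mask of its source, so the [m] steps use every mask but the last, which
    becomes the right-hand vector. *)
Lemma hom_sum_path : (forall i j, sedge (g i) (g j) = path_rel i j) ->
  hom_sum A w =
  ((const_mx 1 : 'rV_#|V|) *m \prod_(0 <= t < m) step t *m (mask m)^T) 0 0.
Proof.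
move=> g_path; rewrite (hom_sum_orients g_path (path_edge_orients m)).
transitivity (\sum_i \sum_j mask m 0 j * (\prod_(0 <= t < m) step t) i j).
  rewrite -(walk_sum m step (fun i j => mask m 0 j)).
  apply: eq_bigr => y _; rewrite big_ord_recr /= mulrAC mulrC; congr (_ * _).
  rewrite -big_split; apply: eq_bigr => t _ /=.
  by rewrite stepE.
rewrite exchange_big mxE; apply: eq_bigr => j _ /=.
rewrite [in RHS]mxE mulr_suml; apply: eq_bigr => i _.
by rewrite [const_mx _ _ _]mxE mul1r [_^T _ _]mxE mulrC.
Qed.

Lemma hom_sum_cycle : (2 <= m)%N ->
    (forall i j, sedge (g i) (g j) = cycle_rel i j) ->
  hom_sum A w = \tr (\prod_(0 <= t < m.+1) step t).
Proof.
move=> m2 g_cycle; rewrite (hom_sum_orients g_cycle (@cycle_edge_orients m.+1 m2)).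
(* The edge from [m] back to 0, with the mask of [m], is the endpoint weight; it becomes the last
   factor under the trace. *)
transitivity (\sum_i \sum_j step m j i * (\prod_(0 <= t < m) step t) i j).
  rewrite -(walk_sum m step (fun i j => step m j i)).
  apply: eq_bigr => y _; rewrite -big_split big_ord_recr /= mulrC stepE.
  have -> : ordS (@ord_max m) = ord0 by apply: val_inj; rewrite /= modnn.
  congr (_ * _); apply: eq_bigr => t _; rewrite stepE; congr (_ * mx_of _ _ (y _)).
  by apply: val_inj => /=; rewrite modn_small // ltnS.
rewrite big_nat_recr //= -mulmxE; apply: eq_bigr => i _; rewrite mxE.
by apply: eq_bigr => j _; rewrite mulrC.
Qed.
End HomSums.

(** * Degenerate 4-cycles *)

Section MatrixOf.
Variables (R : realType) (V : finType).
Implicit Types w : V -> V -> R.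

Lemma mx_of_sym w : (forall x y, w x y = w y x) -> (mx_of w)^T = mx_of w.
Proof. by move=> wC; apply/matrixP => i j; rewrite !mxE wC. Qed.

Lemma mx_ofZ c w : mx_of (fun x y => c * w x y) = c *: mx_of w.
Proof. by apply/matrixP => i j; rewrite !mxE. Qed.

Lemma sum_enum_val (U : nmodType) (f : V -> U) : \sum_(i < #|V|) f (enum_val i) = \sum_x f x.
Proof.
rewrite [RHS](reindex (fun i : 'I_#|V| => enum_val i)) //=.
by apply: onW_bij; exact: enum_val_bij.
Qed.

Lemma hom_sumZ (F : sgraph) (A : F -> {set V}) c w :
  hom_sum A (fun x y => c * w x y) = c ^+ #|edges F| * hom_sum A w.
Proof.
rewrite /hom_sum mulr_sumr; apply: eq_bigr => x _.
by rewrite big_split /= prodr_const.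
Qed.

Lemma mxtrace_mx_of_expr4 w : (forall x y, w x y = w y x) ->
  \tr (mx_of w ^+ 4) = frob2 (mx_of w *m mx_of w).
Proof.
move=> wC; rewrite frob2_mxtrace trmx_mul mx_of_sym // !mulmxE.
by rewrite !exprS expr0 mulr1 !mulrA.
Qed.

(** Real vectors are embedded as complex test functions, which is how the complex hypothesis yields
    a real operator norm bound. *)
Lemma bilin_mx_of w (u v : 'rV[R]_#|V|) :
  bilin w (fun x => (u 0 (enum_rank x))%:C%C) (fun x => (v 0 (enum_rank x))%:C%C)
  = ((u *m mx_of w *m v^T) 0 0)%:C%C.
Proof.
rewrite /bilin -mulmxA mxE -sum_enum_val rmorph_sum; apply: eq_bigr => i _.
rewrite -sum_enum_val mxE mulr_sumr rmorph_sum; apply: eq_bigr => j _.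
by rewrite !mxE !enum_valK !rmorphM /=; ring.
Qed.

End MatrixOf.

Section FourCycles.
Variables (R : realType) (G : sgraph).
Let e := indicator R G.

Lemma indicator_sym x y : e x y = e y x.
Proof. by rewrite /e /indicator sedge_sym. Qed.

(** The cycle [x, y, z, w] grouped by its diagonals. Adjacent vertices differ by irreflexivity, so
    only the diagonals need explicit distinctness. *)
Definition four_cycle (q : (G * G) * (G * G)) : bool :=
  let: ((x, z), (y, w)) := q in
  [&& sedge x y, sedge y z, sedge x w, sedge w z, x != z & y != w].

Lemma card_four_cycle :
  (#|[set q | four_cycle q]| <= inj_hom (cycle_graph 4) G)%N.
Proof.
pose h (q : (G * G) * (G * G)) : {ffun cycle_graph 4 -> G} :=
  [ffun i : 'I_4 => nth q.1.1 [:: q.1.1; q.2.1; q.1.2; q.2.2] i].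
have h_inj : injective h.
  move=> [[x z] [y w]] [[x' z'] [y' w']] /ffunP hh.
  have := hh (@Ordinal 4 0 isT); have := hh (@Ordinal 4 1 isT).
  have := hh (@Ordinal 4 2 isT); have := hh (@Ordinal 4 3 isT).
  by rewrite !ffunE /= => -> -> -> ->.
rewrite -(card_imset _ h_inj); apply: subset_leq_card; apply/subsetP => f.
case/imsetP => -[[x z] [y w]] /[1!inE] /and5P[xy yz xw wz /andP[xz yw]] -> {f}.
have neq a b : sedge a b -> a != b :> G.
  by move=> ab; apply: contraTneq ab => ->; rewrite sedge_irr.
rewrite inE; apply/andP; split.
  have := neq _ _ xy; have := neq _ _ yz; have := neq _ _ xw; have := neq _ _ wz.
  move=> /eqP ? /eqP ? /eqP ? /eqP ?; move/eqP: xz => ?; move/eqP: yw => ?.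
  apply/injectiveP => -[[|[|[|[|//]]]] ?] [[|[|[|[|//]]]] ?];
    rewrite !ffunE /= => ?; (by apply: val_inj) || congruence.
have hS i : sedge (h ((x, z), (y, w)) i) (h ((x, z), (y, w)) (ordS i)).
  case: i => -[|[|[|[|//]]]] ?; rewrite !ffunE //=.
  - by rewrite sedge_sym.
  - by rewrite sedge_sym.
apply/forallP => u; apply/forallP => v; apply/implyP => /andP[_ /orP[]] /eqP ->.
  exact: hS.
by rewrite sedge_sym.
Qed.

(** The left side counts closed walks [x, y, z, w]. Either both diagonals are proper, giving an
    injective 4-cycle, or [x = z] or [y = w], each case contributing at most the sum of the squared
    degrees. *)
Lemma frob2_indicatorM :
  frob2 (mx_of e *m mx_of e) <= (inj_hom (cycle_graph 4) G)%:R
    + 2 * frob2 ((const_mx 1 : 'rV_#|G|) *m mx_of e).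
Proof.
have deg : frob2 ((const_mx 1 : 'rV_#|G|) *m mx_of e)
    = \sum_x \sum_y \sum_z e x y * e x z.
  rewrite /frob2 big_ord1 -(sum_enum_val (fun x => \sum_y \sum_z e x y * e x z)).
  apply: eq_bigr => i _; rewrite mxE.
  have -> : \sum_j (const_mx 1 : 'rV_#|G|) 0 j * mx_of e j i = \sum_y e (enum_val i) y.
    rewrite -[RHS]sum_enum_val; apply: eq_bigr => j _.
    by rewrite !mxE mul1r indicator_sym.
  by rewrite expr2 mulr_suml; apply: eq_bigr => y _; rewrite mulr_sumr.
have -> : frob2 (mx_of e *m mx_of e) =
    \sum_x \sum_z \sum_y \sum_w (e x y * e y z) * (e x w * e w z).
  rewrite -(sum_enum_val (fun x => \sum_z \sum_y \sum_w (e x y * e y z) * (e x w * e w z))).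
  apply: eq_bigr => i _.
  rewrite -(sum_enum_val (fun z => \sum_y \sum_w
    (e (enum_val i) y * e y z) * (e (enum_val i) w * e w z))).
  apply: eq_bigr => k _; rewrite mxE.
  have -> : \sum_j mx_of e i j * mx_of e j k =
      \sum_y e (enum_val i) y * e y (enum_val k).
    by rewrite -[RHS]sum_enum_val; apply: eq_bigr => j _; rewrite !mxE.
  by rewrite expr2 mulr_suml; apply: eq_bigr => y _; rewrite mulr_sumr.
have e_ge0 x y : 0 <= e x y by rewrite ler0n.
apply: (@le_trans _ _ (\sum_x \sum_z \sum_y \sum_w
  ((four_cycle ((x, z), (y, w)))%:R + ((x == z)%:R * (e x y * e x w)
    + (y == w)%:R * (e y x * e y z))))).
  apply: ler_sum => x _; apply: ler_sum => z _.
  apply: ler_sum => y _; apply: ler_sum => w _.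
  have RHS0 : 0 <= (four_cycle ((x, z), (y, w)))%:R + ((x == z)%:R * (e x y * e x w)
      + (y == w)%:R * (e y x * e y z)) by rewrite !addr_ge0 ?mulr_ge0 ?ler0n.
  move: RHS0; rewrite /four_cycle /e /indicator (sedge_sym y x).
  case: (sedge x y); last by rewrite !mul0r.
  case: (sedge y z); last by rewrite mulr0 !mul0r.
  case: (sedge x w); last by rewrite mul0r mulr0.
  case: (sedge w z); last by rewrite !mulr0.
  by rewrite !mulr1; case: (x == z); case: (y == w) => _ /=; lra.
have split4 (f g : G -> G -> G -> G -> R) :
    \sum_x \sum_z \sum_y \sum_w (f x z y w + g x z y w)
    = \sum_x \sum_z \sum_y \sum_w f x z y w + \sum_x \sum_z \sum_y \sum_w g x z y w.
  by do 3 (rewrite -big_split; apply: eq_bigr => ? _); rewrite -big_split.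
rewrite !split4; apply: lerD.
  apply: le_trans (_ : #|[set q | four_cycle q]|%:R <= _); last first.
    by rewrite ler_nat card_four_cycle.
  rewrite -sum1_card natr_sum [leRHS]big_mkcond /= [leLHS]pair_big /=.
  under [leLHS]eq_bigr do rewrite pair_big /=.
  rewrite [leLHS]pair_big; apply: ler_sum => -[[x z] [y w]] _ /=.
  by rewrite inE /=; case: ifP => _; rewrite lexx.
rewrite mulr_natl mulr2n deg; apply: lerD.
  apply: ler_sum => x _; rewrite (bigD1 x) //= [X in _ + X]big1 ?addr0.
    by apply: ler_sum => y _; apply: ler_sum => z _; rewrite eqxx mul1r.
  move=> z zx; do 2 (apply: big1 => ? _); by rewrite eq_sym (negPf zx) mul0r.
rewrite [leRHS]exchange_big /=; apply: ler_sum => x _.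
rewrite [leRHS]exchange_big /=; apply: ler_sum => z _.
apply: ler_sum => y _; rewrite (bigD1 y) //= [X in _ + X]big1 ?addr0.
  by rewrite eqxx mul1r.
by move=> w wy; rewrite eq_sym (negPf wy) mul0r.
Qed.

End FourCycles.

(** * The normalized operators *)

Section Normalized.
Variables (R : realType) (C delta : R).
Hypotheses (C0 : 0 < C) (delta0 : 0 <= delta) (delta1 : delta <= 1).
Variables (G : sgraph) (H : G -> G -> R).
Local Notation n := #|G|.
Hypothesis n0 : (0 < n)%N.
Hypothesis G_C4 : (inj_hom (cycle_graph 4) G)%:R <= C * n%:R ^+ 2.
Hypothesis H_ge0 : forall x y, 0 <= H x y.
Hypothesis H_sym : forall x y, H x y = H y x.
Hypothesis H_C4 : \tr (mx_of H ^+ 4) <= C * n%:R ^+ 4.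
Hypothesis GH : forall a b : G -> R[i],
  l2norm a <= Num.sqrt n%:R -> l2norm b <= Num.sqrt n%:R ->
  Normc.normc (bilin (indicator R G) a b / (n%:R `^ (3 / 2))%:C%C
               - bilin H a b / (n%:R ^+ 2)%:C%C) <= delta.

Let N0 : (0 : R) < n%:R. Proof. by rewrite ltr0n. Qed.

Let s : R := Num.sqrt n%:R.
Let s0 : 0 < s. Proof. by rewrite sqrtr_gt0. Qed.
Let s2 : s ^+ 2 = n%:R. Proof. by rewrite sqr_sqrtr // ltW. Qed.

Definition normG x y : R := (Num.sqrt n%:R)^-1 * indicator R G x y.
Definition normH x y : R := n%:R^-1 * H x y.

Lemma normG_ge0 x y : 0 <= normG x y.
Proof. by rewrite mulr_ge0 ?invr_ge0 ?sqrtr_ge0 ?ler0n. Qed.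

Lemma normH_ge0 x y : 0 <= normH x y.
Proof. by rewrite mulr_ge0 ?invr_ge0 ?ler0n. Qed.

Lemma normG_sym x y : normG x y = normG y x.
Proof. by rewrite /normG indicator_sym. Qed.

Lemma normH_sym x y : normH x y = normH y x.
Proof. by rewrite /normH H_sym. Qed.

Let T1 := mx_of normG.
Let T2 := mx_of normH.

Let T1E : T1 = s^-1 *: mx_of (indicator R G). Proof. exact: mx_ofZ. Qed.
Let T2E : T2 = n%:R^-1 *: mx_of H. Proof. exact: mx_ofZ. Qed.

Lemma powR_3_2 : n%:R `^ (3 / 2) = n%:R * s.
Proof.
have -> : 3 / 2 = 1 + 2^-1 :> R by field.
rewrite powRD; last by rewrite (gt_eqF N0) implybT.
by rewrite powRr1 ?powR12_sqrt ?ler0n.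
Qed.

(** The form of [T1 - T2] is [n] times the difference in [GH], as [n^(-1/2) = n * n^(-3/2)] and
    [n^(-1) = n * n^(-2)]; this [n] is the squared radius of the test vectors. *)
Lemma opbound2_normG_normH : opbound2 (T1 - T2) (delta ^+ 2).
Proof.
apply: opbound2_bilin => // u v un vn.
have l2 (a : 'rV[R]_n) : frob2 a <= n%:R ->
    l2norm (fun x => (a 0 (enum_rank x))%:C%C) <= Num.sqrt n%:R.
  move=> an; rewrite /l2norm ler_wsqrtr // -sum_enum_val.
  rewrite /frob2 big_ord1 in an.
  rewrite (eq_bigr (fun j => a 0 j ^+ 2)) // => j _.
  by rewrite /= enum_valK expr0n addr0 sqrtr_sqr real_normK ?num_real.
have := GH (l2 u un) (l2 v vn).
rewrite !bilin_mx_of powR_3_2 -!fmorphV -!rmorphM -rmorphB /=.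
rewrite expr0n addr0 sqrtr_sqr => le_delta.
have -> : (u *m (T1 - T2) *m v^T) 0 0 = ((u *m mx_of (indicator R G) *m v^T) 0 0
   / (n%:R * s) - (u *m mx_of H *m v^T) 0 0 / n%:R ^+ 2) * n%:R.
  rewrite T1E T2E mulmxBr mulmxBl mxE [X in _ + X]mxE.
  rewrite -!scalemxAr -!scalemxAl [in LHS]mxE [X in _ - X]mxE.
  by field; rewrite !gt_eqF.
by rewrite normrM (ger0_norm (ltW N0)) ler_wpM2r ?ler0n.
Qed.

Lemma normH_C4 : frob2 (T2 *m T2) <= C.
Proof.
rewrite T2E -scalemxAl -scalemxAr scalerA frob2Z -mxtrace_mx_of_expr4 //.
rewrite -[X in X <= _]mulrC -ler_pdivlMr ?exprn_gt0 ?mulr_gt0 ?invr_gt0 //.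
apply: le_trans H_C4 _; rewrite le_eqVlt; apply/orP; left; apply/eqP.
by field; rewrite gt_eqF.
Qed.

(** From the fourth moment, with [C <= (1 + C) ^+ 2] in place of a root of [C]. *)
Lemma normH_opbound2 : opbound2 T2 (1 + C).
Proof.
apply: opbound2_sym; first by rewrite addr_ge0 ?(ltW C0).
  by apply: mx_of_sym; exact: normH_sym.
by apply: le_trans normH_C4 _; have := C0; nra.
Qed.

(** Since [T1 = (T1 - T2) + T2], the constant is [2 * delta ^+ 2 + 2 * (1 + C)] with
    [delta <= 1]. *)
Lemma normG_opbound2 : opbound2 T1 (4 + 2 * C).
Proof.
rewrite -[T1](subrK T2).
apply: opbound2_le (opbound2D opbound2_normG_normH normH_opbound2) _.
have := delta0; have := delta1; nra.
Qed.

(** The constant is [C] from injective 4-cycles plus [2 * (4 + 2 * C)] from squared degrees, the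
    latter read off the operator norm of [T1] at the all-ones vector. *)
Lemma normG_C4 : frob2 (T1 *m T1) <= 8 + 5 * C.
Proof.
have aE : mx_of (indicator R G) = s *: T1.
  by rewrite T1E scalerA divff ?gt_eqF // scale1r.
have C4 := frob2_indicatorM R G.
have deg : frob2 ((const_mx 1 : 'rV_n) *m mx_of (indicator R G))
    <= (4 + 2 * C) * n%:R ^+ 2.
  rewrite aE -scalemxAr frob2Z s2.
  apply: le_trans (_ : n%:R * ((4 + 2 * C) * n%:R) <= _); last first.
    by rewrite le_eqVlt; apply/orP; left; apply/eqP; ring.
  rewrite ler_wpM2l ?(ltW N0) //; apply: le_trans (normG_opbound2 _) _.
  rewrite ler_wpM2l //; first by have := C0; lra.
  rewrite /frob2 big_ord1; under eq_bigr do rewrite mxE expr1n.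
  by rewrite sumr_const card_ord.
rewrite -(@ler_pM2l _ (n%:R ^+ 2)) ?exprn_gt0 //.
have -> : n%:R ^+ 2 * frob2 (T1 *m T1) =
    frob2 (mx_of (indicator R G) *m mx_of (indicator R G)).
  by rewrite aE -scalemxAl -scalemxAr scalerA frob2Z -expr2 s2.
apply: le_trans C4 _; have := G_C4; have := deg; lra.
Qed.

(** The largest constant so far, serving for all norms at once. *)
Let K := 8 + 5 * C.
Let K1 : 1 <= K. Proof. by rewrite /K; have := C0; lra. Qed.

Let T1_sym : T1^T = T1. Proof. by apply: mx_of_sym; exact: normG_sym. Qed.
Let T2_sym : T2^T = T2. Proof. by apply: mx_of_sym; exact: normH_sym. Qed.
Let T1_ge0 i j : 0 <= T1 i j. Proof. by rewrite mxE normG_ge0. Qed.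
Let T2_ge0 i j : 0 <= T2 i j. Proof. by rewrite mxE normH_ge0. Qed.
Let T1_op : opbound2 T1 K.
Proof. by apply: opbound2_le normG_opbound2 _; rewrite /K; have := C0; lra. Qed.
Let T2_op : opbound2 T2 K.
Proof. by apply: opbound2_le normH_opbound2 _; rewrite /K; have := C0; lra. Qed.
Let T1_C4 : frob2 (T1 *m T1) <= K. Proof. exact: normG_C4. Qed.
Let T2_C4 : frob2 (T2 *m T2) <= K.
Proof. by apply: le_trans normH_C4 _; rewrite /K; have := C0; lra. Qed.

Variables (F : sgraph) (A : F -> {set G}).

Lemma path_count_diff k : sgraph_iso F (path_graph k) ->
  `|n%:R ^+ #|edges F| / n%:R ^+ #|F| * (hom_sum A normG - hom_sum A normH)|
  <= k%:R * (delta * K ^+ k).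
Proof.
case=> f f_bij f_edge; have [g fK gK] := f_bij.
have g_edge i j : sedge (g i) (g j) = path_rel i j.
  by rewrite -f_edge !gK.
rewrite (card_edges_orients fK gK g_edge (path_edge_orients k)) (bij_eq_card f_bij) card_ord.
rewrite (hom_sum_path A normG_sym fK gK g_edge).
rewrite (hom_sum_path A normH_sym fK gK g_edge).
(* With [k] edges and [k + 1] vertices the prefactor is [1 / n]; it cancels the [n] of
   [path_telescope]. *)
rewrite exprS invfM mulrCA mulfV ?mulr1; last by rewrite expf_neq0 // gt_eqF.
rewrite normrM gtr0_norm ?invr_gt0 // ler_pdivrMl //.
have mask01 := @mask01 R F G A k g.
apply: (path_telescope K1 delta0 T1_op T2_op opbound2_normG_normH mask01).
  rewrite /frob2 big_ord1; under eq_bigr do rewrite mxE expr1n.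
  by rewrite sumr_const card_ord.
rewrite frob2_tr /frob2 big_ord1.
apply: le_trans (_ : \sum_(j < n) 1 <= _); last by rewrite sumr_const card_ord.
by apply: ler_sum => j _; have /andP[? ?] := mask01 k j; rewrite exprn_ile1.
Qed.

Lemma cycle_count_diff k : (5 <= k)%N -> sgraph_iso F (cycle_graph k) ->
  `|n%:R ^+ #|edges F| / n%:R ^+ #|F| * (hom_sum A normG - hom_sum A normH)|
  <= k%:R * (delta * K ^+ k).
Proof.
case: k => // m m4 [f f_bij f_edge]; have [g fK gK] := f_bij.
have g_edge i j : sedge (g i) (g j) = cycle_rel i j.
  by rewrite -f_edge !gK.
have m2 : (2 <= m)%N by rewrite ltnW // ltnW.
rewrite (card_edges_orients fK gK g_edge (@cycle_edge_orients m.+1 m2)) (bij_eq_card f_bij) card_ord.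
rewrite (hom_sum_cycle A normG_sym fK gK m2 g_edge).
rewrite (hom_sum_cycle A normH_sym fK gK m2 g_edge).
rewrite divff ?mul1r; last by rewrite expf_neq0 // gt_eqF.
have mask01 := @mask01 R F G A m g.
exact: (cycle_telescope K1 delta0 T1_sym T2_sym T1_ge0 T2_ge0 T1_op T2_op
  opbound2_normG_normH T1_C4 T2_C4 mask01).
Qed.

(** Each edge contributes [1 / s] to the count for [normG] and [1 / n] to that for [normH];
    everything is compared in powers of [s = sqrt n]. *)
Lemma hom_sum_normalize :
  hom_sum A (indicator R G) / n%:R `^ (#|F|%:R - #|edges F|%:R / 2)
    - hom_sum A H / n%:R ^+ #|F| =
  n%:R ^+ #|edges F| / n%:R ^+ #|F| * (hom_sum A normG - hom_sum A normH).
Proof.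
have sn0 : s != 0 by rewrite gt_eqF.
have -> : n%:R `^ (#|F|%:R - #|edges F|%:R / 2) = n%:R ^+ #|F| / s ^+ #|edges F|.
  rewrite powRD; last by rewrite (gt_eqF N0) implybT.
  rewrite powR_mulrn ?ler0n // powRN [_ / 2]mulrC powRrM powR12_sqrt ?ler0n //.
  by rewrite powR_mulrn ?sqrtr_ge0.
have -> : n%:R ^+ #|edges F| = (s ^+ #|edges F|) ^+ 2 :> R by rewrite -s2 exprAC.
rewrite !hom_sumZ !exprVn -/s -s2 [(s ^+ 2) ^+ #|edges F|]exprAC.
by field; rewrite !expf_neq0.
Qed.

End Normalized.

(** * Choice of [delta] and conclusion *)

Local Open Scope complex_scope.

Theorem corollary4p2 (R : realType) (F : sgraph) (hF : long_cycle_or_path F)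
    (eps C : R) (heps : 0 < eps) (hC : 0 < C) :
  exists delta : R, 0 < delta /\
    forall (n : nat) (G : sgraph), #|G| = n ->
      (inj_hom (cycle_graph 4) G)%:R <= C * n%:R ^+ 2 ->
    forall H : G -> G -> R,
      (forall x y, 0 <= H x y) ->
      (forall x y, H x y = H y x) ->
      \tr (mx_of H ^+ 4) <= C * n%:R ^+ 4 ->
      (forall a b : G -> R[i],
         l2norm a <= Num.sqrt n%:R -> l2norm b <= Num.sqrt n%:R ->
         Normc.normc (bilin (indicator R G) a b / (n%:R `^ (3 / 2))%:C
                      - bilin H a b / (n%:R ^+ 2)%:C) <= delta) ->
    forall A : F -> {set G},
      `| hom_sum A (indicator R G)
           / n%:R `^ (#|F|%:R - #|edges F|%:R / 2)
         - hom_sum A H / n%:R ^+ #|F| | <= eps.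
Proof.
have [k [F0 Fk]] : exists k, inhabited F /\ (((5 <= k)%N /\ sgraph_iso F (cycle_graph k)) \/
    sgraph_iso F (path_graph k)).
  case: hF => [[k k5 Fk]|[k k1 Fk]]; exists k; (split; last by tauto).
    case: k k5 Fk => // m _ [f [g _ _] _]; exact: (inhabits (g ord0)).
  by case: Fk => f [g _ _] _; exact: (inhabits (g ord0)).
set K := 8 + 5 * C.
have K0 : 0 < K by rewrite /K; lra.
(* The summand 1 keeps [M] visibly positive; [M] depends only on [k] and [C], so [delta] is uniform
   in [G] and [H]. *)
pose M : R := 1 + k%:R * K ^+ k.
have M0 : 0 < M by rewrite ltr_pwDl // mulr_ge0 // exprn_ge0 // ltW.
(* The cap at 1 serves the operator norm bound of [T1]. *)
exists (Num.min 1 (eps / M)); split; first by rewrite lt_min ltr01 divr_gt0.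
set delta := Num.min _ _.
have delta1 : delta <= 1 by rewrite ge_min lexx.
have delta0 : 0 <= delta by rewrite le_min ler01 divr_ge0 // ltW.
have bound : k%:R * (delta * K ^+ k) <= eps.
  have : delta <= eps / M by rewrite ge_min lexx orbT.
  rewrite ler_pdivlMr // => ?; rewrite mulrCA; apply: le_trans (_ : delta * M <= _) => //.
  by rewrite ler_wpM2l // lerDr.
move=> n G <- C4 H H0 Hsym H4 GH A.
(* The normalization needs [n > 0]. If [G] is empty, no map from the nonempty [F] exists and both
   sums vanish. *)
have [G0|n0] := posnP #|G|.
  case: F0 => v0.
  have hom0 (w : G -> G -> R) : hom_sum A w = 0.
    by apply: big1 => x _; have := card0_eq G0 (x v0).
  by rewrite !hom0 !mul0r subrr normr0 ltW.
rewrite (hom_sum_normalize _ n0); apply: le_trans bound.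
case: Fk => [[k5 Fk]|Fk].
  exact: cycle_count_diff.
exact: path_count_diff.
Qed.
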